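(* Let $\mu$ be a pre-permuton. There exists a unique triple $(\mu^{\mathrm{incr}},\mu^{\mathrm{decr}},\mu^{\mathrm{sub}})$ of finite (positive) Borel measures on $[0,1]^2$ satisfying: $$\mu=\mu^{\mathrm{incr}}+\mu^{\mathrm{decr}}+\mu^{\mathrm{sub}},$$ $$\widetilde{\mathrm{LIS}}_\infty(\mu^{\mathrm{incr}})=\mu^{\mathrm{incr}}([0,1]^2)=\widetilde{\mathrm{LIS}}_\infty(\mu),$$ $$\widetilde{\mathrm{LDS}}_\infty(\mu^{\mathrm{decr}})=\mu^{\mathrm{decr}}([0,1]^2)=\widetilde{\mathrm{LDS}}_\infty(\mu).$$ Moreover the following properties hold: (i) the measures $\mu^{\mathrm{incr}},\mu^{\mathrm{decr}},\mu^{\mathrm{sub}}$ are pairwise (mutually) singular; (ii) for all $k\in\mathbb{N}^*$, $\widetilde{\mathrm{LIS}}_k(\mu^{\mathrm{incr}})=\widetilde{\mathrm{LIS}}_k(\mu)$ and $\widetilde{\mathrm{LDS}}_k(\mu^{\mathrm{decr}})=\widetilde{\mathrm{LDS}}_k(\mu)$; (iii) $\widetilde{\mathrm{LIS}}_1(\mu^{\mathrm{decr}})=\widetilde{\mathrm{LIS}}_1(\mu^{\mathrm{sub}})=\widetilde{\mathrm{LDS}}_1(\mu^{\mathrm{sub}})=\widetilde{\mathrm{LDS}}_1(\mu^{\mathrm{incr}})=0$; (iv) $\widetilde\lambda^\mu=\widetilde\lambda^{\mu^{\mathrm{incr}}}$.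
   Context: $\mathbb{N}^*=\{1,2,\dots\}$. A pre-permuton is a Borel probability measure on $[0,1]^2$ whose two marginals have no atoms. A subset $A\subset[0,1]^2$ is nondecreasing (resp. nonincreasing) if for all $(x_1,y_1),(x_2,y_2)\in A$, $(x_2-x_1)(y_2-y_1)\ge 0$ (resp. $\le 0$). It is $k$-nondecreasing (resp. $k$-nonincreasing) if it is a union of $k$ nondecreasing (resp. nonincreasing) subsets. For a finite Borel measure $\nu$ on $[0,1]^2$ and $k\in\mathbb{N}^*$, $\widetilde{\mathrm{LIS}}_k(\nu):=\sup_A \nu(A)$ over closed $k$-nondecreasing $A\subset[0,1]^2$, and $\widetilde{\mathrm{LDS}}_k(\nu):=\sup_A\nu(A)$ over closed $k$-nonincreasing $A$; $\widetilde{\mathrm{LIS}}_0(\nu)=\widetilde{\mathrm{LDS}}_0(\nu):=0$. $\widetilde{\mathrm{LIS}}_\infty(\nu):=\lim_{k\to\infty}\widetilde{\mathrm{LIS}}_k(\nu)$ and $\widetilde{\mathrm{LDS}}_\infty(\nu):=\lim_{k\to\infty}\widetilde{\mathrm{LDS}}_k(\nu)$ (nondecreasing limits). For $(x,y)\in[0,1]^2$, $\widetilde\lambda^\nu(x,y):=\big(\widetilde{\mathrm{LIS}}_k(\nu|_{[0,x]\times[0,y]})-\widetilde{\mathrm{LIS}}_{k-1}(\nu|_{[0,x]\times[0,y]})\big)_{k\in\mathbb{N}^*}$, where $\nu|_{[0,x]\times[0,y]}$ is the (unnormalized) restriction of $\nu$. *)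

(* Defs.v *)
From HB Require Import structures.
From mathcomp Require Import all_boot all_order all_algebra.
From mathcomp Require Import all_classical all_reals all_analysis.
Import Order.TTheory GRing.Theory Num.Theory.
Import numFieldNormedType.Exports.

Set Implicit Arguments.
Unset Strict Implicit.
Unset Printing Implicit Defensive.

Local Open Scope classical_set_scope.
Local Open Scope ring_scope.

(* A finite Borel measure on [0,1]^2 is represented by a finite measure on
   R * R vanishing outside [0,1]^2. The product sigma-algebra on R * R is its
   Borel sigma-algebra, since R is second countable. Measures are functions
   defined on all sets, so that equality of measures has to be restricted to
   measurable sets. *)

Definition unit_square (R : realType) : set (R * R) := `[0, 1] `*` `[0, 1].
Arguments unit_square : clear implicits.

Definition on_unit_square (R : realType) (nu : set (R * R) -> \bar R) : Prop :=
  nu (~` unit_square R) = 0%E.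

Definition atomless (R : realType) (m : set R -> \bar R) : Prop :=
  forall x : R, m [set x] = 0%E.

Definition pre_permuton (R : realType) (mu : probability (R * R)%type R) :
    Prop :=
  [/\ on_unit_square mu,
      atomless (pushforward mu (fst : R * R -> R)) &
      atomless (pushforward mu (snd : R * R -> R))].

Definition nondecreasing_set (R : realType) (A : set (R * R)) : Prop :=
  forall p q : R * R, A p -> A q -> 0 <= (q.1 - p.1) * (q.2 - p.2).

Definition nonincreasing_set (R : realType) (A : set (R * R)) : Prop :=
  forall p q : R * R, A p -> A q -> (q.1 - p.1) * (q.2 - p.2) <= 0.

Definition k_nondecreasing (R : realType) (k : nat) (A : set (R * R)) : Prop :=
  exists F : 'I_k -> set (R * R),
    (forall i, nondecreasing_set (F i)) /\ A = \bigcup_i F i.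

Definition k_nonincreasing (R : realType) (k : nat) (A : set (R * R)) : Prop :=
  exists F : 'I_k -> set (R * R),
    (forall i, nonincreasing_set (F i)) /\ A = \bigcup_i F i.

Definition LIS (R : realType) (k : nat) (nu : set (R * R) -> \bar R) : \bar R :=
  if k is 0 then 0%E else
  ereal_sup [set nu A | A in [set A : set (R * R) |
    [/\ A `<=` unit_square R, closed A & k_nondecreasing k A]]].

Definition LDS (R : realType) (k : nat) (nu : set (R * R) -> \bar R) : \bar R :=
  if k is 0 then 0%E else
  ereal_sup [set nu A | A in [set A : set (R * R) |
    [/\ A `<=` unit_square R, closed A & k_nonincreasing k A]]].

Definition LISoo (R : realType) (nu : set (R * R) -> \bar R) : \bar R :=
  limn (fun k => LIS k nu).

Definition LDSoo (R : realType) (nu : set (R * R) -> \bar R) : \bar R :=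
  limn (fun k => LDS k nu).

Definition corner (R : realType) (x y : R) : set (R * R) :=
  `[0, x] `*` `[0, y].

Lemma measurable_corner (R : realType) (x y : R) : measurable (corner x y).
Proof. by apply: measurableX; exact: measurable_itv. Qed.

(* Entries are numbered from 0: [RSshape nu x y j] is the (j+1)-st entry of the
   shape at (x, y). *)
Definition RSshape (R : realType) (nu : set (R * R) -> \bar R) (x y : R) :
    nat -> \bar R :=
  fun j => let nuxy := mrestr nu (measurable_corner x y) in
    (LIS j.+1 nuxy - LIS j nuxy)%E.

Definition mutually_singular (R : realType) (m n : set (R * R) -> \bar R) :
    Prop :=
  exists S : set (R * R), [/\ measurable S, m S = 0%E & n (~` S) = 0%E].

Definition monotone_decomposition (R : realType) (mu : set (R * R) -> \bar R)
    (mincr mdecr msub : {finite_measure set (R * R)%type -> \bar R}) : Prop :=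
  [/\ [/\ on_unit_square mincr, on_unit_square mdecr & on_unit_square msub],
      forall A : set (R * R), measurable A ->
        mu A = (mincr A + mdecr A + msub A)%E,
      LISoo mincr = mincr (unit_square R) /\
        mincr (unit_square R) = LISoo mu &
      LDSoo mdecr = mdecr (unit_square R) /\
        mdecr (unit_square R) = LDSoo mu].

(* Main.v *)
(* Choose finite unions of monotone closed sets whose measures approach
   [LISoo mu], and let [I] be their union. Since finite unions of such sets are
   again such sets, [mu I = LISoo mu], and every closed [k]-nondecreasing set is
   [mu]-almost contained in [I]: otherwise adding it to [I] would exceed the
   supremum. The same construction gives [D] for nonincreasing sets. A
   nondecreasing set and a nonincreasing set meet inside the union of a vertical
   and a horizontal line, which is null because the marginals have no atoms, so
   [I] and [D] may be taken disjoint. The components are the restrictions of [mu]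
   to [I], [D] and the complement of [I `|` D]. *)
Require Import Defs.
From mathcomp Require Import all_boot all_order all_algebra.
From mathcomp Require Import all_classical all_reals all_analysis.
Import Order.TTheory GRing.Theory Num.Theory.
Import numFieldNormedType.Exports.
Set Implicit Arguments.
Unset Strict Implicit.
Unset Printing Implicit Defensive.
Local Open Scope classical_set_scope.
Local Open Scope ring_scope.

(** * Sets of maximal mass for a class of sets stable under finite unions *)

Section carrier.
Context {d : measure_display} {T : measurableType d} {R : realType}.
Implicit Types (m : {finite_measure set T -> \bar R}) (K : set (set T)).
Implicit Types (A B I D : set T).
Local Open Scope ereal_scope.

(** [I] may lie outside [K]: it arises as a countable union of members of [K], and one of two
    carriers is later trimmed by a null set. *)
Definition carrier m K I :=
  [/\ measurable I, m I = ereal_sup [set m A | A in K] &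
      forall A, K A -> m (A `\` I) = 0].

(* [measureDI] with the finite-measure coercion on both sides, so that the
   result can be rewritten with equations about [m]. *)
Lemma fmeasureDI m A B : measurable A -> measurable B ->
  m A = m (A `\` B) + m (A `&` B).
Proof. exact: measureDI. Qed.

(** Partial unions stay in [K], and continuity from below passes the bound to the full union. *)
Lemma measure_bigcup_le_sup m K (F : nat -> set T) :
  (forall A, K A -> measurable A) -> setU_closed K -> (forall i, K (F i)) ->
  m (\bigcup_i F i) <= ereal_sup [set m A | A in K].
Proof.
move=> mK UK KF; pose G n := \big[setU/set0]_(i < n.+1) F i.
have KG i : K (G i).
  rewrite /G; elim: i => [|i IH].
    by rewrite big_ord_recl big_ord0 setU0; exact: KF.
  by rewrite big_ord_recr; apply: UK.
rewrite -bigcup_bigsetU_bigcup.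
apply: (cvge_le (F := \oo) (f := m \o G)).
  by apply: nearW => i; apply: ereal_sup_ubound; exists (G i).
apply: nondecreasing_cvg_mu => [i||]; first exact/mK/KG.
  by apply: bigcup_measurable => i _; exact/mK/KG.
move=> i j ij; rewrite subsetEset; exact: subset_bigsetU.
Qed.

Lemma carrier_exists m K :
  (forall A, K A -> measurable A) -> setU_closed K -> K set0 ->
  exists I, carrier m K I.
Proof.
move=> mK UK K0.
have [|u uK u_sup] := @ereal_sup_seq R [set m A | A in K].
  by apply/set0P; exists (m set0); exists set0.
have /choice[F FP] : forall i, exists A, K A /\ m A = u i.
  by move=> i; have [A KA <-] := uK i; exists A.
have KF i : K (F i) by case: (FP i).
have mI : measurable (\bigcup_i F i).
  by apply: bigcup_measurable => i _; exact/mK/KF.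
have mIE : m (\bigcup_i F i) = ereal_sup [set m A | A in K].
  apply/eqP; rewrite eq_le measure_bigcup_le_sup//=.
  apply: cvge_le u_sup; apply: nearW => i; rewrite -(FP i).2.
  by apply: le_measure; rewrite ?inE//; [exact/mK/KF|exact: bigcup_sup].
exists (\bigcup_i F i); split => // A KA.
have mA : measurable A := mK A KA.
have mAI := measurableD mA mI.
have Ifin : m (\bigcup_i F i) \is a fin_num by exact: fin_num_measure.
apply/eqP; rewrite -measure_le0 -(leeD2lE _ _ Ifin) adde0 -measureU ?setDIK//.
(* As [I] itself need not be in [K], [A] is adjoined to every [F i]; the enlarged sets are in [K],
   so their union has mass at most the supremum. *)
rewrite mIE; apply: (@le_trans _ _ (m (\bigcup_i (A `|` F i)))).
  apply: le_measure; rewrite ?inE; first exact: measurableU.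
    by apply: bigcup_measurable => i _; apply: measurableU => //; exact: mK.
  by move=> x [[i _ Fx]|[Ax _]]; [exists i => //; right|exists 0%N => //; left].
by apply: measure_bigcup_le_sup => // i; exact: UK.
Qed.

(** Up to null sets, a member of [K] lies in [I] and avoids [B]. Hence the part of [I] outside [B]
    already has the supremal mass [m I], which is finite, and nothing is left for the part inside
    [B]. *)
Lemma measure_carrierI m K I B : (forall A, K A -> measurable A) ->
  carrier m K I -> measurable B -> (forall A, K A -> m (A `&` B) = 0) ->
  m (I `&` B) = 0.
Proof.
move=> mK [mI IE KI] mB KB.
have mIB : measurable (I `\` B) by exact: measurableD.
have IBfin : m (I `\` B) \is a fin_num by exact: fin_num_measure.
apply/eqP; rewrite -measure_le0 -(leeD2lE _ _ IBfin) adde0.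
rewrite -(fmeasureDI m mI mB) IE.
apply: ge_ereal_sup => _ [A KA <-]; have mA := mK A KA.
rewrite (fmeasureDI m mA mB) KB// adde0 (fmeasureDI m (measurableD mA mB) mI).
rewrite (_ : m (_ `\` _) = 0) ?add0e; last first.
  apply: (subset_measure0 _ _ _ (KI A KA)); try by do 2?apply: measurableD.
  by move=> x [[]].
apply: le_measure; rewrite ?inE//.
  by apply: measurableI => //; apply: measurableD.
by move=> x [[]].
Qed.

(** Two uses of [measure_carrierI] turn nullity of the intersections of members of [K] and [K'] into
    nullity of the intersection of the carriers, which can then be removed from [D]. *)
Lemma disjoint_carriers m K K' :
  (forall A, K A -> measurable A) -> setU_closed K -> K set0 ->
  (forall A, K' A -> measurable A) -> setU_closed K' -> K' set0 ->
  (forall A B, K A -> K' B -> m (A `&` B) = 0) ->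
  exists I D, [/\ carrier m K I, carrier m K' D & I `&` D = set0].
Proof.
move=> mK UK K0 mK' UK' K'0 KK'.
have [I cI] := @carrier_exists m K mK UK K0.
have [D cD] := @carrier_exists m K' mK' UK' K'0.
have IK' B : K' B -> m (B `&` I) = 0.
  move=> KB; rewrite setIC; apply: measure_carrierI cI _ _ => //.
    exact: mK'.
  by move=> A KA; exact: KK'.
have [mI _ _] := cI; have [mD DE KD] := cD.
have DI : m (D `&` I) = 0 by exact: measure_carrierI cD _ _.
exists I, (D `\` I); split => //; last by rewrite setDIK.
split; first exact: measurableD.
  by rewrite -DE (fmeasureDI m mD mI) DI adde0.
move=> A KA; have mA := mK' A KA.
have mDI := measurableD mD mI.
have mAD := measurableD mA mD.
apply/eqP; rewrite -measure_le0.
apply: (@le_trans _ _ (m ((A `\` D) `|` (A `&` I)))).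
  apply: le_measure; rewrite ?inE//; first exact: measurableD.
    by apply: measurableU => //; exact: measurableI.
  move=> x [Ax DIx]; have [Ix|nIx] := pselect (I x); first by right.
  by left; split=> // Dx; exact: DIx.
apply: le_trans (measureU2 _ _ _) _ => //; first exact: measurableI.
by rewrite [X in X + _]KD// [X in _ + X]IK'// add0e.
Qed.

Lemma measure_carrier_ext m K I A : carrier m K I -> K A -> measurable A ->
  forall B, measurable B -> m (A `&` B `&` I) = m (A `&` B).
Proof.
move=> [mI _ KI] KA mA B mB; have mAB := measurableI _ _ mA mB.
rewrite [RHS](fmeasureDI m mAB mI) (_ : m (_ `\` _) = 0) ?add0e//.
apply: (subset_measure0 _ _ _ (KI A KA)); try by do 2?apply: measurableD.
by move=> x [[]].
Qed.

(* The total mass of [n] is approached on sets of [K], and [n <= m] vanishes on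
   those sets outside [I]; so [n] lives on [I], where it has the same finite mass
   as [m]. *)
Lemma carrier_unique m (n : {finite_measure set T -> \bar R}) K I :
  (forall A, K A -> measurable A) -> carrier m K I ->
  (forall A, measurable A -> n A <= m A) ->
  n setT = ereal_sup [set n A | A in K] ->
  n setT = ereal_sup [set m A | A in K] ->
  forall A, measurable A -> n A = m (A `&` I).
Proof.
move=> mK [mI IE KI] nm nT nTm A mA.
have nI0 : n (~` I) = 0.
  have mIC := measurableC mI.
  have Ifin : n I \is a fin_num by exact: fin_num_measure.
  apply/eqP; rewrite -measure_le0 -(leeD2lE _ _ Ifin) adde0 -measureU ?setICr//.
  rewrite setUv [leLHS]nT; apply: ge_ereal_sup => _ [B KB <-]; have mB := mK B KB.
  rewrite (fmeasureDI n mB mI) (_ : n (_ `\` _) = 0) ?add0e.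
    by apply: le_measure; rewrite ?inE//; exact: measurableI.
  apply/eqP; rewrite -measure_le0 -(KI B KB); apply: nm; exact: measurableD.
have nAI B : measurable B -> n B = n (B `&` I).
  move=> mB; rewrite (fmeasureDI n mB mI) (_ : n (_ `\` _) = 0) ?add0e//.
  apply: (subset_measure0 _ _ _ nI0); [exact: measurableD|exact: measurableC|].
  by move=> x [].
have nI : n I = m I by rewrite IE -nTm (nAI setT)// setTI.
have mAI := measurableI _ _ mA mI; have mIA := measurableD mI mA.
(* For the reverse inequality, [n] and [m] have equal mass on [I] and [n] is at most [m] on the rest
   of [I], so [n] cannot fall short on the part in [A]. *)
rewrite nAI//; apply/eqP; rewrite eq_le nm//=.
have fin : m (I `\` A) \is a fin_num by exact: fin_num_measure.
rewrite -(leeD2lE _ _ fin) [A `&` I]setIC -(fmeasureDI m mI mA) -nI.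
rewrite (fmeasureDI n mI mA).
by apply: leeD2r; exact: nm.
Qed.

End carrier.

(** * Closed finite unions of monotone sets, and suprema over them *)

Section monotone_unions.
Context {R : realType}.
Implicit Types (Q : set (set (R * R))) (A B : set (R * R)).
Implicit Types nu : set (R * R) -> \bar R.

Lemma open_measurable_prodR (U : set (R * R)) : open U -> measurable U.
Proof.
move=> oU.
pose box (q : (rat * rat) * (rat * rat)) : set (R * R) :=
  `]ratr q.1.1, ratr q.1.2[ `*` `]ratr q.2.1, ratr q.2.2[.
(* Rational boxes that leave [U] are replaced by the empty set, so that the union runs over a whole
   countable type. *)
pose F q := if `[< box q `<=` U >] then box q else set0.
suff -> : U = \bigcup_q F q.
  apply: countable_bigcupT_measurable; first exact: countableP.
  move=> q; rewrite /F; case: asboolP => // _.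
  by apply: measurableX; exact: measurable_itv.
apply/seteqP; split=> [[x y] Uxy|p [q _]]; last first.
  by rewrite /F; case: asboolP => // + bp; exact.
have /nbhs_ballP[e /= e0 eU] : nbhs (x, y) U by exact: open_nbhs_nbhs.
have xe : x - e < x by rewrite ltrBlDr ltrDl.
have ex : x < x + e by rewrite ltrDl.
have ye : y - e < y by rewrite ltrBlDr ltrDl.
have ey : y < y + e by rewrite ltrDl.
have [a +] := rat_in_itvoo xe; rewrite in_itv/= => /andP[a1 a2].
have [b +] := rat_in_itvoo ex; rewrite in_itv/= => /andP[b1 b2].
have [a' +] := rat_in_itvoo ye; rewrite in_itv/= => /andP[a'1 a'2].
have [b' +] := rat_in_itvoo ey; rewrite in_itv/= => /andP[b'1 b'2].
exists ((a, b), (a', b')) => //; rewrite /F; case: asboolP => [_|].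
  by split; rewrite /= in_itv/=; apply/andP.
case=> -[u v] [/=]; rewrite !in_itv/= => /andP[au ub] /andP[av vb].
apply: eU; split; rewrite /ball/= ltr_distlC.
  by rewrite (lt_trans a1 au) (lt_trans ub b2).
by rewrite (lt_trans a'1 av) (lt_trans vb b'2).
Qed.

Lemma closed_measurable_prodR A : closed A -> measurable A.
Proof.
move=> cA; rewrite -[A]setCK; apply: measurableC.
by apply: open_measurable_prodR; rewrite openC.
Qed.

(** Keeping [Q] abstract treats the nondecreasing and nonincreasing cases together. *)
Definition closed_unions Q (k : nat) : set (set (R * R)) :=
  [set A | [/\ A `<=` unit_square R, closed A &
    exists F : 'I_k -> set (R * R), (forall i, Q (F i)) /\ A = \bigcup_i F i]].

Definition finite_closed_unions Q : set (set (R * R)) :=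
  \bigcup_k closed_unions Q k.

(* Convertible to [LIS] for [Q := nondecreasing_set] and to [LDS] for
   [Q := nonincreasing_set]. *)
Definition union_sup Q (k : nat) nu : \bar R :=
  if k is 0 then 0%E else ereal_sup [set nu A | A in closed_unions Q k].

Lemma closed_unions_measurable Q k A : closed_unions Q k A -> measurable A.
Proof. by case=> _ /closed_measurable_prodR. Qed.

Lemma closed_unionsU Q j k A B : closed_unions Q j A -> closed_unions Q k B ->
  closed_unions Q (j + k) (A `|` B).
Proof.
move=> [As cA [F [QF AF]]] [Bs cB [G [QG BG]]]; split.
- by rewrite subUset.
- exact: closedU.
exists (fun i : 'I_(j + k) =>
  match fintype.split i with inl a => F a | inr b => G b end); split.
  by move=> i; case: fintype.split.
rewrite AF BG; apply/seteqP; split=> [x [[i _ Fx]|[i _ Gx]]|x [i _]].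
- exists (unsplit (inl i)) => //; by rewrite unsplitK.
- exists (unsplit (inr i)) => //; by rewrite unsplitK.
- by case: fintype.split => a ?; [left|right]; exists a.
Qed.

Lemma closed_unions_set0 Q k : Q set0 -> closed_unions Q k set0.
Proof.
move=> Q0; split; [exact: sub0set|exact: closed0|].
by exists (fun=> set0); split=> //; rewrite bigcup0.
Qed.

Lemma closed_unionsS Q k A : Q set0 ->
  closed_unions Q k A -> closed_unions Q k.+1 A.
Proof.
move=> Q0 QA; rewrite -addn1 -[A]setU0.
by apply: closed_unionsU => //; exact: closed_unions_set0.
Qed.

Lemma finite_closed_unions_measurable Q A :
  finite_closed_unions Q A -> measurable A.
Proof. by move=> [k _] /closed_unions_measurable. Qed.

Lemma finite_closed_unionsU Q : setU_closed (finite_closed_unions Q).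
Proof.
by move=> A B [j _ QA] [k _ QB]; exists (j + k)%N => //; exact: closed_unionsU.
Qed.

Lemma finite_closed_unions_set0 Q : Q set0 -> finite_closed_unions Q set0.
Proof. by exists 0%N => //; exact: closed_unions_set0. Qed.

Lemma eq_union_sup Q k nu nu' :
  (forall A, finite_closed_unions Q A -> nu A = nu' A) ->
  union_sup Q k nu = union_sup Q k nu'.
Proof.
case: k => // k e; congr ereal_sup; apply: eq_imagel => A QA.
by apply: e; exists k.+1.
Qed.

Lemma union_sup1_eq0 Q nu : Q set0 ->
  (forall A, finite_closed_unions Q A -> nu A = 0%E) -> union_sup Q 1 nu = 0%E.
Proof.
move=> Q0 nu0; apply/eqP; rewrite eq_le; apply/andP; split.
  by apply: ge_ereal_sup => _ [A QA <-]; rewrite nu0//; exists 1%N.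
apply: ereal_sup_ubound; exists set0; first exact: closed_unions_set0.
by apply: nu0; exact: finite_closed_unions_set0.
Qed.

(** Padding with empty pieces makes the sequence nondecreasing, so its limit is a supremum over [k]
    of suprema over sets. *)
Lemma lim_union_sup Q nu : Q set0 -> nu set0 = 0%E ->
  limn (fun k => union_sup Q k nu) =
  ereal_sup [set nu A | A in finite_closed_unions Q].
Proof.
move=> Q0 nu0.
have homoS k : (union_sup Q k nu <= union_sup Q k.+1 nu)%E.
  case: k => [|k].
    apply: ereal_sup_ubound; exists set0 => //; exact: closed_unions_set0.
  apply: le_ereal_sup => _ [A QA <-]; exists A => //; exact: closed_unionsS.
have homo :
    {homo (fun k => union_sup Q k nu) : n m / (n <= m)%N >-> (n <= m)%E}.
  exact: (homo_leq (f := fun k => union_sup Q k nu) (@le_refl _ _) (@le_trans _ _)).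
rewrite (cvg_lim _ (ereal_nondecreasing_cvgn homo))//.
apply/eqP; rewrite eq_le; apply/andP; split; apply: ge_ereal_sup.
  move=> _ [k _ <-]; case: k => [|k].
    apply: ereal_sup_ubound; exists set0 => //; exact: finite_closed_unions_set0.
  by apply: le_ereal_sup => _ [A QA <-]; exists A => //; exists k.+1.
move=> _ [A [k _ QA] <-]; apply: le_ereal_sup_tmp.
(* The index is shifted because the term at [0] is [0] by convention and not a supremum. *)
exists (union_sup Q k.+1 nu); first by exists k.+1.
by apply: ereal_sup_ubound; exists A => //; exact: closed_unionsS.
Qed.

End monotone_unions.

Lemma negligible_bigcup_ord d (T : sigmaRingType d) (R : realFieldType)
    (mu : {measure set T -> \bar R}) (k : nat) (F : 'I_k -> set T) :
  (forall i, mu.-negligible (F i)) -> mu.-negligible (\bigcup_i F i).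
Proof.
move=> F0; pose G n := if insub n is Some i then F i else set0.
apply: (@negligibleS _ _ _ _ (\bigcup_n G n)).
  by move=> x [i _ Fx]; exists i => //; rewrite /G valK.
apply: negligible_bigcup => n; rewrite /G; case: insub => //.
exact: negligible_set0.
Qed.

(** * Null intersections of sets of opposite monotonicity *)

Section pre_permuton.
Context {R : realType} (mu : probability (R * R)%type R).
Hypothesis hmu : pre_permuton mu.

(* Any two points of the intersection lie on a common vertical or horizontal
   line, so one of its points determines a cross that contains it. *)
Lemma negligible_nondecreasingI_nonincreasing (A B : set (R * R)) :
  nondecreasing_set A -> nonincreasing_set B -> mu.-negligible (A `&` B).
Proof.
case: hmu => _ mu1 mu2 incA decB.
have [->|/set0P[p [Ap Bp]]] := eqVneq (A `&` B) set0.
  exact: negligible_set0.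
apply: (@negligibleS _ _ _ _ ((fst @^-1` [set p.1]) `|` (snd @^-1` [set p.2]))).
  move=> q [Aq Bq].
  have /eqP : (q.1 - p.1) * (q.2 - p.2) = 0.
    by apply/eqP; rewrite eq_le incA// decB.
  by rewrite mulf_eq0 !subr_eq0 => /orP[] /eqP; [left|right].
have mX := @measurable_fst _ _ R R measurableT _ (measurable_set1 p.1).
have mY := @measurable_snd _ _ R R measurableT _ (measurable_set1 p.2).
rewrite !setTI in mX mY.
by apply: negligibleU; apply/negligibleP => //; [exact: mu1|exact: mu2].
Qed.

Lemma measure_nondecreasingI_nonincreasing (A B : set (R * R)) :
  finite_closed_unions (@nondecreasing_set R) A ->
  finite_closed_unions (@nonincreasing_set R) B -> mu (A `&` B) = 0%E.
Proof.
move=> KA KB; apply: measure_negligible.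
  by apply: measurableI; apply: finite_closed_unions_measurable; eassumption.
have [j _ [_ _ [F [QF ->]]]] := KA; have [k _ [_ _ [G [QG ->]]]] := KB.
(* The pieces need not be measurable, so the argument runs through negligible sets. *)
rewrite setI_bigcupl; apply: negligible_bigcup_ord => a.
rewrite setI_bigcupr; apply: negligible_bigcup_ord => b.
exact: negligible_nondecreasingI_nonincreasing.
Qed.

End pre_permuton.

Lemma addeI (R : realDomainType) (x y z : \bar R) :
  x \is a fin_num -> (x + y = x + z)%E -> y = z.
Proof.
move=> xfin e; apply/le_anti.
by rewrite -(leeD2lE y z xfin) -(leeD2lE z y xfin) e lexx. Qed.

(** * Restriction of a measure to a carrier *)

Section decomposition.
Context {R : realType}.
Implicit Types (m n : {finite_measure set (R * R)%type -> \bar R}).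
Implicit Types (Q : set (set (R * R))) (A I : set (R * R)).

(** The further restriction to [B] serves the corners in [RSshape]. *)
Lemma union_sup_restr_carrier m Q I (mI : measurable I) B
    (mB : measurable B) k :
  carrier m (finite_closed_unions Q) I ->
  union_sup Q k (mrestr (mrestr m mI) mB) = union_sup Q k (mrestr m mB).
Proof.
move=> cI; apply: eq_union_sup => A KA.
apply: (measure_carrier_ext cI KA) mB; exact: finite_closed_unions_measurable KA.
Qed.

Lemma mrestr_carrier m Q I (mI : measurable I) A :
  carrier m (finite_closed_unions Q) I -> finite_closed_unions Q A ->
  mrestr m mI A = m A.
Proof.
move=> cI KA; have mA := finite_closed_unions_measurable KA.
by have := measure_carrier_ext cI KA mA measurableT; rewrite setIT.
Qed.

Lemma lim_union_sup_restr_carrier m Q I (mI : measurable I) : Q set0 ->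
  on_unit_square m -> carrier m (finite_closed_unions Q) I ->
  limn (fun k => union_sup Q k (mrestr m mI)) = mrestr m mI (unit_square R) /\
  mrestr m mI (unit_square R) = limn (fun k => union_sup Q k m).
Proof.
move=> Q0 m0 cI; have [_ IE _] := cI.
have mE : mrestr m mI (unit_square R) = limn (fun k => union_sup Q k m).
  rewrite lim_union_sup// -IE /mrestr.
  have mS : measurable (unit_square R) by apply: measurableX; exact: measurable_itv.
  rewrite [RHS](fmeasureDI m mI mS) setIC (_ : m (_ `\` _) = 0%E) ?add0e//.
  apply: (subset_measure0 _ _ _ m0); [exact: measurableD|exact: measurableC|].
  by move=> x [].
split; last exact: mE.
rewrite mE; congr (limn _); apply/funext => k.
by apply: eq_union_sup => A; exact: mrestr_carrier.
Qed.

Lemma dominated_carrier_unique m n Q I A : Q set0 ->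
  carrier m (finite_closed_unions Q) I -> on_unit_square n ->
  (forall B, measurable B -> (n B <= m B)%E) ->
  limn (fun k => union_sup Q k n) = n (unit_square R) ->
  n (unit_square R) = limn (fun k => union_sup Q k m) ->
  measurable A -> n A = m (A `&` I).
Proof.
move=> Q0 cI n0 nm; rewrite !lim_union_sup// => nE nmE mA.
have mS : measurable (unit_square R) by apply: measurableX; exact: measurable_itv.
have nT : n setT = n (unit_square R).
  by rewrite (fmeasureDI n measurableT mS) setTI setTD [X in X + _]n0 add0e.
apply: (carrier_unique (@finite_closed_unions_measurable R Q) cI) => //.
  by rewrite nT -nE.
by rewrite nT.
Qed.

End decomposition.

Theorem theorem2p12 (R : realType) (mu : probability (R * R)%type R)
    (hmu : pre_permuton mu) :
  exists mincr mdecr msub : {finite_measure set (R * R)%type -> \bar R},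
  [/\ monotone_decomposition mu mincr mdecr msub
      /\ (forall nincr ndecr nsub : {finite_measure set (R * R)%type -> \bar R},
            monotone_decomposition mu nincr ndecr nsub ->
            forall A : set (R * R), measurable A ->
              [/\ nincr A = mincr A, ndecr A = mdecr A & nsub A = msub A]),
      [/\ mutually_singular mincr mdecr, mutually_singular mincr msub
        & mutually_singular mdecr msub],
      (forall k : nat, (0 < k)%N ->
         LIS k mincr = LIS k mu /\ LDS k mdecr = LDS k mu),
      [/\ LIS 1 mdecr = 0%E, LIS 1 msub = 0%E, LDS 1 msub = 0%E
        & LDS 1 mincr = 0%E]
    & (forall x y : R, x \in `[0, 1] -> y \in `[0, 1] ->
         RSshape mu x y = RSshape mincr x y)].
Proof.
pose m : {finite_measure set (R * R)%type -> \bar R} := mu.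
have m0 : on_unit_square m by case: hmu.
pose Qi := @nondecreasing_set R; pose Qd := @nonincreasing_set R.
have Qi0 : Qi set0 by [].
have Qd0 : Qd set0 by [].
have LISE k (nu : set (R * R) -> \bar R) : LIS k nu = union_sup Qi k nu by [].
have LDSE k (nu : set (R * R) -> \bar R) : LDS k nu = union_sup Qd k nu by [].
have [|I [D [cI cD ID0]]] := @disjoint_carriers _ _ _ m
    (finite_closed_unions Qi) (finite_closed_unions Qd)
    (@finite_closed_unions_measurable R Qi) (@finite_closed_unionsU R Qi)
    (finite_closed_unions_set0 Qi0)
    (@finite_closed_unions_measurable R Qd) (@finite_closed_unionsU R Qd)
    (finite_closed_unions_set0 Qd0).
  exact: measure_nondecreasingI_nonincreasing.
have [mI _ KI] := cI; have [mD _ KD] := cD.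
have mS : measurable (~` (I `|` D)) by apply/measurableC/measurableU.
have mE A : measurable A ->
    m A = (m (A `&` I) + m (A `&` D) + m (A `&` ~` (I `|` D)))%E.
  move=> mA; have mID := measurableU _ _ mI mD.
  rewrite (fmeasureDI m mA mID) addeC; congr (_ + _)%E.
  rewrite setIUr; apply: measureU; try exact: measurableI.
  by rewrite setIACA ID0 setI0.
have restr0 B (mB : measurable B) : on_unit_square (mrestr m mB).
  apply: (subset_measure0 _ _ _ m0).
  - apply: measurableI => //; apply: measurableC.
    by apply: measurableX; exact: measurable_itv.
  - by apply: measurableC; apply: measurableX; exact: measurable_itv.
  - by move=> x [].
exists (mrestr m mI), (mrestr m mD), (mrestr m mS).
(* Used with [C] a carrier: [A] is almost contained in [C], which [B] avoids. *)
have restr_null B (mB : measurable B) A C : measurable A -> measurable C ->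
    m (A `\` C) = 0%E -> B `&` C = set0 -> mrestr m mB A = 0%E.
  move=> mA mC AC0 BC0; apply: (subset_measure0 _ _ _ AC0).
  - exact: measurableI.
  - exact: measurableD.
  - move=> x [Ax Bx]; split=> // Cx; suff : (B `&` C) x by rewrite BC0.
    by [].
have DI0 : D `&` I = set0 by rewrite setIC.
have SI0 : ~` (I `|` D) `&` I = set0.
  by apply/seteqP; split=> // x [nID Ix]; apply: nID; left.
have SD0 : ~` (I `|` D) `&` D = set0.
  by apply/seteqP; split=> // x [nID Dx]; apply: nID; right.
have singular B C (mB : measurable B) (mC : measurable C) : C `&` B = set0 ->
    mutually_singular (mrestr m mB) (mrestr m mC).
  move=> CB0; exists C; split => //; first by rewrite /mrestr CB0 measure0.
  by rewrite /mrestr setICl measure0.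
split.
- split.
    split => //; first by split; exact: restr0.
    + exact: (lim_union_sup_restr_carrier mI Qi0 m0 cI).
    + exact: (lim_union_sup_restr_carrier mD Qd0 m0 cD).
  move=> ni nd ns [[ni0 nd0 ns0] nE [ni1 ni2] [nd1 nd2]] A mA.
  (* Positivity of the other two components gives the domination by [m]. *)
  have niA : forall B, measurable B -> ni B = m (B `&` I).
    move=> B mB; apply: (dominated_carrier_unique Qi0 cI ni0) => // C mC.
    by rewrite [leRHS]nE// -addeA leeDl// adde_ge0.
  have ndA : forall B, measurable B -> nd B = m (B `&` D).
    move=> B mB; apply: (dominated_carrier_unique Qd0 cD nd0) => // C mC.
    by rewrite [leRHS]nE// addeAC leeDr// adde_ge0.
  split; [exact: niA|exact: ndA|].
  (* The third component follows by cancelling the first two, which is legitimate as their masses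
     are finite. *)
  have fin : (m (A `&` I) + m (A `&` D))%E \is a fin_num.
    by rewrite fin_numD !fin_num_measure//; exact: measurableI.
  have := mE A mA; rewrite [LHS]nE// niA// ndA// => e.
  exact: addeI fin e.
- by split; apply: singular.
- move=> k _; rewrite !LISE !LDSE.
  by split; apply: eq_union_sup => A; exact: mrestr_carrier.
- rewrite !LISE !LDSE; split; apply: union_sup1_eq0 => // A KA;
    have mA := finite_closed_unions_measurable KA.
  + exact: (restr_null _ mD _ _ mA mI (KI A KA)).
  + exact: (restr_null _ mS _ _ mA mI (KI A KA)).
  + exact: (restr_null _ mS _ _ mA mD (KD A KA)).
  + exact: (restr_null _ mI _ _ mA mD (KD A KA)).
- move=> x y _ _; apply/funext => j; rewrite /RSshape !LISE.
  by congr (_ - _)%E; apply/esym/union_sup_restr_carrier.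
Qed.
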